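(* Let $n\ge1$. For $\mathbf{a}=(a_{1/2},a_{3/2})$, $$\prod_{i=1}^n\left(a_{1/2}(x_i^{1/2}+x_i^{-1/2})+a_{3/2}(x_i^{3/2}+x_i^{-3/2})\right)=\sum_{q=0}^n a_{3/2}^q\,\phi_r(\mathbf{a})\,\mathrm{ch}^{SO(2n+1)}_{((3/2)^q,(1/2)^r)}(\mathbf{x},\overline{\mathbf{x}},1),\qquad r=n-q,$$ where $$\phi_0(\mathbf{a})=1,\quad\phi_1(\mathbf{a})=a_{1/2}-a_{3/2},\quad\phi_2(\mathbf{a})=a_{1/2}^2-2a_{1/2}a_{3/2},$$ $$\phi_r(\mathbf{a})=a_{1/2}\,\phi_{r-1}(\mathbf{a})-a_{1/2}a_{3/2}\,\phi_{r-2}(\mathbf{a})+a_{3/2}^3\,\phi_{r-3}(\mathbf{a})\quad\text{if } r\ge3 .$$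
   Context: $\mathbf{x}=(x_1,\dots,x_n)$ are indeterminates (with formal square roots $x_i^{1/2}$), $\overline{\mathbf{x}}=(x_1^{-1},\dots,x_n^{-1})$; $a_{1/2},a_{3/2}$ are arbitrary scalar parameters. $((3/2)^q,(1/2)^r)$ is the weight whose first $q$ components are $3/2$ and last $r$ components are $1/2$. $\mathrm{ch}^{SO(2n+1)}_\lambda(\mathbf{x},\overline{\mathbf{x}},1)$ is the (spin) character of the irreducible representation (of the spin covering group) of $SO(2n+1)$ of highest weight $\lambda$, restricted to elements with eigenvalues $(\mathbf{x},\overline{\mathbf{x}},1)$; it is given by Weyl's formula $\sum_w\mathrm{sgn}(w)\mathbf{x}^{w(\lambda+\rho)}/\sum_w\mathrm{sgn}(w)\mathbf{x}^{w(\rho)}$ with $w$ running over all permutations and sign changes of the $n$ coordinates, $\mathrm{sgn}(w)$ the determinant of $w$, and $\rho=(n-\tfrac12,n-\tfrac32,\dots,\tfrac12)$. *)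

(* Defs.v *)
From HB Require Import structures.
From mathcomp Require Import all_boot all_order all_fingroup all_algebra.
From mathcomp Require Import mpoly.

Set Implicit Arguments.
Unset Strict Implicit.
Unset Printing Implicit Defensive.

Import GRing.Theory.
Local Open Scope ring_scope.

(* Weights of the spin group of SO(2n+1) have half-integral coordinates. They *)
(* are stored DOUBLED: the weight (v_1, ..., v_n) is the integer column       *)
(* vector (2 v_1, ..., 2 v_n).                                                *)
Definition weight (n : nat) := 'cV[int]_n.

(* rho = (n - 1/2, n - 3/2, ..., 1/2); the index i starts at 0.               *)
Definition rho (n : nat) : weight n :=
  \col_(i < n) ((n.*2)%:Z - (i.*2.+1)%:Z).

(* ((3/2)^q, (1/2)^(n - q)), for q <= n.                                      *)
Definition weight32 (n q : nat) : weight n :=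
  \col_(i < n) (if (i < q)%N then 3 else 1).

(* Each pair (s, e) gives exactly one element of the Weyl group of type B_n:  *)
(* it permutes the coordinates by s, then negates those i for which e i.      *)
Definition signed_perm_mx (n : nat) (s : 'S_n) (e : {ffun 'I_n -> bool}) :
    'M[int]_n :=
  diag_mx (\row_i (-1) ^+ e i) *m perm_mx s.

Section Characters.

Variables (F : fieldType) (n : nat).

(* y i plays the role of x_i^{1/2}.                                           *)
Implicit Types (y : 'I_n -> F) (v lambda : weight n).

(* x^v, i.e. the product of the y_i ^ (2 v_i).                                *)
Definition xpow y v : F := \prod_(i < n) y i ^ v i 0.

Definition alt_sum y v : F :=
  \sum_(s : 'S_n) \sum_(e : {ffun 'I_n -> bool})
    (\det (signed_perm_mx s e))%:~R * xpow y (signed_perm_mx s e *m v).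

(* Weyl's character formula for type B_n. The quotient is meaningful when     *)
(* alt_sum y (rho n) != 0, as is the case for indeterminate y.                *)
Definition ch_SO_odd y lambda : F :=
  alt_sum y (lambda + rho n) / alt_sum y (rho n).

End Characters.

(* Here a and b stand for a_{1/2} and a_{3/2}.                                *)
Fixpoint phi (R : pzRingType) (a b : R) (r : nat) : R :=
  match r with
  | 0 => 1
  | 1 => a - b
  | 2 => a ^+ 2 - 2 * a * b
  | ((r3.+1 as r2).+1 as r1).+1 =>
      a * phi a b r1 - a * b * phi a b r2 + b ^+ 3 * phi a b r3
  end.

(* The field K(x_1^{1/2}, ..., x_n^{1/2}) with K = Frac(R): the mpoly         *)
(* variable 'X_i is the formal square root x_i^{1/2}.                         *)

Definition sqrtx (R : idomainType) (n : nat) (i : 'I_n) :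
  {fraction {mpoly R[n]}} := tofrac ('X_i : {mpoly R[n]}).

Definition scal (R : idomainType) (n : nat) (c : R) :
  {fraction {mpoly R[n]}} := tofrac (c%:MP : {mpoly R[n]}).

(* Main.v *)
Require Import Defs.
From mathcomp Require Import all_boot all_order all_fingroup all_algebra.
From mathcomp Require Import mpoly ring zify.

Set Implicit Arguments.
Unset Strict Implicit.
Unset Printing Implicit Defensive.

Import GRing.Theory.
Local Open Scope ring_scope.

(** Every alternating sum over the Weyl group of type B_n is the determinant of
    the matrix with entries y_i^(v_j) - y_i^(-v_j), where y_i = x_i^(1/2) and v
    is the doubled weight.  Up to a factor depending on i only, these entries
    are polynomials in t_i = x_i + x_i^-1: with V_0 = 1, V_1 = X + d and
    V_(k+2) = X V_(k+1) - V_k, the entry for v_j = 2k + 1 is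
    (y_i - y_i^-1) V_k(t_i) with d = 1, and the entry for v_j = 2k + 2 is
    (y_i^2 - y_i^-2) V_k(t_i) with d = 0, in which case V_k = U_k is a Chebyshev
    polynomial of the second kind.

    For v = rho one gets all the degrees n-1, ..., 0 with d = 1.  Since the
    polynomials are monic, the determinant is the Vandermonde determinant of the
    t_i.  For v = ((3/2)^q, (1/2)^(n-q)) + rho one gets d = 0 and the degrees
    n, ..., 0 with n - q omitted ([alt_sum_rho], [alt_sum_weight32]).  The
    factor y_i + y_i^-1 left in the quotient also divides the i-th factor of the
    product of the theorem, which is
      (y_i + y_i^-1) (a - b + b t_i),   a = a_(1/2), b = a_(3/2).

    What remains is a dual Cauchy identity: the product of the a - b + b t_i,
    times the Vandermonde determinant of the t_i, is the sum over q of
    b^q phi_(n-q) times the determinant with n - q omitted.  If b is nonzero,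
    put s = - (a - b) / b.  Up to b^n, the left-hand side is the determinant of
    (U_n, ..., U_0) in the n + 1 points t_1, ..., t_n, s, and expanding it along
    the row of s gives the right-hand side ([alternant_extend],
    [alternant_extend_prod]), because b^r U_r(s) = (-1)^r phi_r ([phi_cheb]).
    The last identity holds since phi also satisfies the shorter recurrence
    phi_r = (a - b) phi_(r-1) - b^2 phi_(r-2): the cubic denominator
    1 - a t + a b t^2 - b^3 t^3 of the generating function of phi cancels
    against its numerator 1 - b t.  If b = 0 only the term q = 0 survives.

    Dividing by the denominator of Weyl's formula requires that it be nonzero
    for indeterminate y, in every characteristic.  By the Vandermonde determinant
    it is enough that y_i^2 differs from 1 for all i, and from y_j^2 and y_j^-2
    for all j different from i ([alt_sum_rho_neq0]). *)

(** * Alternants of monic polynomials *)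

Section MonicAlternant.

Variable R : comNzRingType.
Implicit Types (p : nat -> {poly R}) (s : R).

Lemma det_scale_rows n (r : 'I_n -> R) (A : 'I_n -> 'I_n -> R) :
  \det (\matrix_(i, j) (r i * A i j)) =
  \prod_i r i * \det (\matrix_(i, j) A i j).
Proof.
transitivity (\det (diag_mx (\row_i r i) *m \matrix_(i, j) A i j)).
  by congr (\det _); apply/matrixP => i j; rewrite mul_diag_mx !mxE.
by rewrite det_mulmx det_diag; congr (_ * _); apply: eq_bigr => i _; rewrite mxE.
Qed.

(** Columns are indexed by decreasing degree, matching the order of the
    coordinates of the weight [rho]. *)
Definition alternant n p (t : 'I_n -> R) : R :=
  \det (\matrix_(i < n, j < n) (p (n - j.+1)%N).[t i]).

Definition monic_family p := forall k, p k \is monic /\ size (p k) = k.+1.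

(** Passing from the powers of the variable to a monic family is a unitriangular
    change of basis. *)
Lemma alternant_monic n p (t : 'I_n -> R) :
  monic_family p -> alternant p t = alternant (fun k => 'X^k) t.
Proof.
move=> hp; pose C := \matrix_(k < n, j < n) (p (n - j.+1)%N)`_(n - k.+1).
have -> : alternant p t =
    \det ((\matrix_(i < n, k < n) ('X^(n - k.+1)).[t i]) *m C).
  congr (\det _); apply/matrixP => i j; rewrite !mxE.
  have hs : (size (p (n - j.+1)%N) <= n)%N.
    by rewrite (hp _).2 subnSK ?leq_subr.
  rewrite (horner_coef_wide _ hs) (reindex_inj rev_ord_inj) /=.
  by apply: eq_bigr => k _; rewrite !mxE hornerXn mulrC.
rewrite det_mulmx [X in _ * X]det_trig.
  rewrite big1 ?mulr1 // => k _.
  by rewrite !mxE -[RHS](monicP (hp (n - k.+1)%N).1) /lead_coef (hp _).2.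
apply/is_trig_mxP => k j lt_kj; rewrite !mxE nth_default // (hp _).2.
by rewrite ltn_sub2l ?ltnS // (leq_ltn_trans lt_kj).
Qed.

Definition extend n (t : 'I_n -> R) s (i : 'I_n.+1) : R :=
  if unlift ord_max i is Some j then t j else s.

Lemma extend_max n (t : 'I_n -> R) s : extend t s ord_max = s.
Proof. by rewrite /extend unlift_none. Qed.

Lemma extend_lift n (t : 'I_n -> R) s i : extend t s (lift ord_max i) = t i.
Proof. by rewrite /extend liftK. Qed.

(** The degrees n, ..., 0 with n - q omitted; [bump q] enumerates the column
    indices other than q. *)
Definition gap_alternant n p (t : 'I_n -> R) (q : nat) : R :=
  \det (\matrix_(i < n, j < n) (p (n - bump q j)%N).[t i]).

(** Expansion along the row of the additional point s. *)
Lemma alternant_extend n p (t : 'I_n -> R) s :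
  alternant p (extend t s) =
  \sum_(q < n.+1) (-1) ^+ (n + q) * (p (n - q)%N).[s] * gap_alternant p t q.
Proof.
rewrite /alternant (expand_det_row _ ord_max); apply: eq_bigr => q _.
rewrite !mxE extend_max subSS /cofactor mulrCA mulrA; congr (_ * \det _).
by apply/matrixP => i j; rewrite !mxE extend_lift subSS.
Qed.

Lemma gap_alternant0 n p (t : 'I_n -> R) :
  gap_alternant p t 0 = alternant p t.
Proof. by []. Qed.

(** As the monic family is arbitrary, it can be chosen so that every polynomial
    of positive degree is a multiple of 'X - s: the row of s then has a single
    nonzero entry. *)
Lemma alternant_extend_prod n p (t : 'I_n -> R) s : monic_family p ->
  alternant p (extend t s) = \prod_(i < n) (t i - s) * alternant p t.
Proof.
move=> hp; rewrite !(alternant_monic _ hp).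
pose p' k : {poly R} := if k is k'.+1 then 'X^k' * ('X - s%:P) else 1.
have hp' : monic_family p'.
  case=> [|k]; first by rewrite monic1 size_poly1.
  rewrite /= monicMr ?monicXn ?monicXsubC // size_Mmonic ?monicXsubC //.
    by rewrite size_XsubC size_polyXn addn2.
  by rewrite -size_poly_eq0 size_polyXn.
rewrite -(alternant_monic _ hp') alternant_extend big_ord_recr /= big1 => [|q _].
  rewrite add0r subnn hornerC mulr1 addnn -signr_odd odd_double mul1r.
  rewrite /gap_alternant /alternant.
  rewrite -det_scale_rows; congr (\det _); apply/matrixP => i j; rewrite !mxE.
  rewrite /bump leqNgt ltn_ord add0n -[(n - j)%N]prednK ?subn_gt0 //=.
  by rewrite hornerM hornerXsubC mulrC subnS.
rewrite -[(n - q)%N]prednK ?subn_gt0 //=.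
by rewrite hornerM hornerXsubC subrr !mulr0 mul0r.
Qed.

End MonicAlternant.

Lemma alternant_neq0 (R : idomainType) n p (t : 'I_n -> R) :
  monic_family p -> injective t -> alternant p t != 0.
Proof.
move=> hp; elim: n t => [|n IHn] t t_inj.
  by rewrite /alternant det_mx00 oner_neq0.
pose t' i := t (lift ord_max i).
have -> : alternant p t = alternant p (extend t' (t ord_max)).
  congr (\det _); apply/matrixP => i j; rewrite !mxE /extend.
  by case: unliftP => [k|] ->.
rewrite alternant_extend_prod // mulf_neq0 ?IHn //.
  apply/prodf_neq0 => i _; rewrite subr_eq0 (inj_eq t_inj) eq_sym.
  exact: neq_lift.
by move=> i j /t_inj /lift_inj.
Qed.

(** * Chebyshev polynomials and antisymmetrized powers *)

(** The Chebyshev polynomials of the second kind for d = 0 and of the third or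
    fourth kind for d = -1 or 1, rescaled to be monic.  The two values 0 and 1
    are those for which [antisym z (e + k.*2)] is a multiple of
    [antisym z e], with e = 2 and e = 1. *)
Fixpoint cheb (R : nzRingType) (d : R) (k : nat) : {poly R} :=
  match k with
  | 0 => 1
  | 1 => 'X + d%:P
  | (k2.+1 as k1).+1 => 'X * cheb d k1 - cheb d k2
  end.

Lemma cheb_monic (R : comNzRingType) (d : R) : monic_family (cheb d).
Proof.
have H k : (cheb d k \is monic /\ size (cheb d k) = k.+1) /\
           (cheb d k.+1 \is monic /\ size (cheb d k.+1) = k.+2).
  elim: k => [|k [[IH1m IH1s] [IH2m IH2s]]].
    by rewrite /= monic1 size_poly1 monicXaddC size_XaddC.
  split=> //=; rewrite -/(cheb d k.+1).
  have hs : size ('X * cheb d k.+1) = k.+3.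
    by rewrite mulrC size_mulX ?IH2s // -size_poly_eq0 IH2s.
  have lt_s : (size (- cheb d k) < size ('X * cheb d k.+1)%R)%N.
    by rewrite size_polyN IH1s hs leqW.
  rewrite size_polyDl // hs; split=> //.
  by rewrite monicE lead_coefDl // -monicE monicMr ?monicX.
by move=> k; case: (H k).
Qed.

Section AntisymmetrizedPowers.

Variable F : fieldType.
Implicit Types z : F.

Definition antisym z (m : int) : F := z ^ m - z ^ (- m).

Lemma antisym_rec z m : z != 0 ->
  antisym z (m + 4%:Z) = (z ^+ 2 + z ^- 2) * antisym z (m + 2%:Z) - antisym z m.
Proof.
move=> z0; rewrite /antisym !opprD !expfzDr // -!exprz_inv.
have -> : z ^ 4%:Z = z ^+ 4 by [].
have -> : z ^ 2%:Z = z ^+ 2 by [].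
have -> : z^-1 ^ 4%:Z = z ^- 4 by rewrite -exprVn.
have -> : z^-1 ^ 2%:Z = z ^- 2 by rewrite -exprVn.
by field.
Qed.

(** Both sides satisfy the recurrence of [cheb], by [antisym_rec]; the hypothesis
    on d extends it one step below k = 0 and so settles k = 1. *)
Lemma antisym_cheb z d (e : int) k : z != 0 ->
    antisym z (e - 2%:Z) = - d * antisym z e ->
  antisym z (e + k.*2%:Z) = antisym z e * (cheb d k).[z ^+ 2 + z ^- 2].
Proof.
move=> z0 he.
have H j : antisym z (e + j.*2%:Z) =
             antisym z e * (cheb d j).[z ^+ 2 + z ^- 2] /\
           antisym z (e + j.+1.*2%:Z) =
             antisym z e * (cheb d j.+1).[z ^+ 2 + z ^- 2].
  elim: j => [|j [IH1 IH2]].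
    rewrite addr0 hornerC mulr1; split=> //=.
    have -> : e + 1.*2%:Z = e - 2%:Z + 4%:Z by lia.
    rewrite antisym_rec // subrK he hornerD hornerX hornerC; ring.
  split=> //; have -> : e + j.+2.*2%:Z = e + j.*2%:Z + 4%:Z.
    by rewrite -addrA -PoszD addnC.
  rewrite antisym_rec // -[_ + 2]addrA -PoszD addnC IH1.
  have -> : (2 + j.*2)%N = j.+1.*2 by [].
  rewrite IH2 [cheb d j.+2]/= -/(cheb d j.+1) hornerD hornerN hornerM hornerX.
  ring.
by case: (H k).
Qed.

End AntisymmetrizedPowers.

(** * Weyl alternating sums as alternants *)

Section Alternants.

Variable F : fieldType.

(** For a fixed permutation the sum over sign changes factors over the
    coordinates, each factor being an antisymmetrized power. *)
Lemma alt_sum_det n (y : 'I_n -> F) (v : weight n) :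
  alt_sum y v = \det (\matrix_(i < n, j < n) antisym (y i) (v j 0)).
Proof.
rewrite /alt_sum [RHS]/determinant; apply: eq_bigr => s _.
have -> : \prod_i (\matrix_(i0, j) antisym (y i0) (v j 0)) i (s i) =
    \prod_(i < n) \sum_(b : bool) (-1) ^+ b * y i ^ ((-1) ^+ b * v (s i) 0).
  apply: eq_bigr => i _; rewrite mxE big_bool /= expr1 expr0 !mulN1r !mul1r.
  by rewrite addrC.
rewrite bigA_distr_bigA big_distrr /=; apply: eq_bigr => e _.
rewrite /signed_perm_mx det_mulmx det_diag det_perm big_split /= mulrA.
congr (_ * _).
  rewrite rmorphM rmorph_sign rmorph_prod mulrC; congr (_ * _).
  by apply: eq_bigr => i _; rewrite mxE rmorph_sign.
apply: eq_bigr => i _; congr (_ ^ _).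
by rewrite -mulmxA mul_diag_mx -row_permE !mxE.
Qed.

Variables (n : nat) (y : 'I_n -> F).
Hypothesis y_neq0 : forall i, y i != 0.

Let t i := y i ^+ 2 + y i ^- 2.

Lemma alt_sum_rho :
  alt_sum y (rho n) = \prod_(i < n) (y i - (y i)^-1) * alternant (cheb 1) t.
Proof.
rewrite alt_sum_det -det_scale_rows; congr (\det _); apply/matrixP => i j.
rewrite !mxE.
have -> : n.*2%:Z - j.*2.+1%:Z = 1 + (n - j.+1).*2%:Z.
  by have := ltn_ord j; lia.
rewrite (@antisym_cheb _ _ 1) //.
by rewrite mulN1r /antisym [RHS]opprB.
Qed.

(** Adding 3 to the first q coordinates of [rho] and 1 to the others gives the
    doubled entries 2 (n - i) + 2 with the value 2 (n - q) + 2 skipped. *)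
Lemma alt_sum_weight32 (q : 'I_n.+1) :
  alt_sum y (weight32 n q + rho n) =
  \prod_(i < n) (y i ^+ 2 - y i ^- 2) * gap_alternant (cheb 0) t q.
Proof.
rewrite alt_sum_det -det_scale_rows; congr (\det _); apply/matrixP => i j.
rewrite !mxE.
have -> : (if (j < q)%N then 3 else 1) + (n.*2%:Z - j.*2.+1%:Z) =
    2%:Z + (n - bump q j).*2%:Z.
  by rewrite /bump; have := ltn_ord j; have := ltn_ord q; case: (ltnP j q); lia.
by rewrite (@antisym_cheb _ _ 0) // oppr0 mul0r /antisym oppr0 subrr.
Qed.

End Alternants.

(** * The coefficients phi and the dual Cauchy identity *)

(** Two-step recurrence: phi is a homogeneous Chebyshev sequence in a - b
    and b. *)
Lemma phi_rec (R : comNzRingType) (a b : R) r :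
  phi a b r.+2 = (a - b) * phi a b r.+1 - b ^+ 2 * phi a b r.
Proof.
elim: r => [|r IHr]; first by rewrite /=; ring.
have -> : phi a b r.+3 = a * phi a b r.+2 - a * b * phi a b r.+1 +
  b ^+ 3 * phi a b r by [].
rewrite IHr; ring.
Qed.

Section DualCauchy.

Variable F : fieldType.
Implicit Types (a b : F).

(** Both sides satisfy the recurrence [phi_rec], up to the sign. *)
Lemma phi_cheb a b r : b != 0 ->
  b ^+ r * (cheb 0 r).[- ((a - b) / b)] = (-1) ^+ r * phi a b r.
Proof.
move=> b0.
have H : b ^+ r * (cheb 0 r).[- ((a - b) / b)] = (-1) ^+ r * phi a b r /\
    b ^+ r.+1 * (cheb 0 r.+1).[- ((a - b) / b)] = (-1) ^+ r.+1 * phi a b r.+1.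
  elim: r => [|r [IH1 IH2]].
    rewrite /= hornerC hornerD hornerX hornerC; split; first by ring.
    by field.
  split=> //; rewrite phi_rec [cheb 0 r.+2]/= -/(cheb 0 r.+1).
  rewrite hornerD hornerN hornerM hornerX mulrBr.
  have -> : b ^+ r.+2 * (- ((a - b) / b) * (cheb 0 r.+1).[- ((a - b) / b)]) =
      - (a - b) * (b ^+ r.+1 * (cheb 0 r.+1).[- ((a - b) / b)]).
    by rewrite [b ^+ r.+2]exprS; field.
  have -> : b ^+ r.+2 * (cheb 0 r).[- ((a - b) / b)] =
      b ^+ 2 * (b ^+ r * (cheb 0 r).[- ((a - b) / b)]).
    by rewrite !exprS; ring.
  by rewrite IH1 IH2 !exprS; ring.
by case: H.
Qed.

Lemma phi_b0 a r : phi a 0 r = a ^+ r.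
Proof.
have H : phi a 0 r = a ^+ r /\ phi a 0 r.+1 = a ^+ r.+1.
  elim: r => [|r [IH1 IH2]]; first by rewrite /= subr0.
  by split=> //; rewrite phi_rec IH2 subr0 expr0n mul0r subr0 -exprS.
by case: H.
Qed.

(** The dual Cauchy identity for the symplectic groups of ranks n and 1: dividing
    by the alternant on the left turns the gap alternants into the characters
    of the fundamental weights of Sp(2n), and phi plays the role of the
    characters of Sp(2). *)
Lemma prod_gap_alternant n (t : 'I_n -> F) a b :
  \prod_(i < n) (a - b + b * t i) * alternant (cheb 0) t =
  \sum_(q < n.+1) b ^+ q * phi a b (n - q) * gap_alternant (cheb 0) t q.
Proof.
have [->|b0] := eqVneq b 0.
  rewrite [RHS]big_ord_recl [X in _ = _ + X]big1 => [|q _]; last first.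
    by rewrite expr0n !mul0r.
  rewrite addr0 subn0 phi_b0 mul1r gap_alternant0; congr (_ * _).
  under eq_bigr => i _ do rewrite mul0r addr0 subr0.
  by rewrite prodr_const card_ord.
(* s is the common root of the factors a - b + b t, as polynomials in t. *)
pose s := - ((a - b) / b).
have -> : \prod_(i < n) (a - b + b * t i) = b ^+ n * \prod_(i < n) (t i - s).
  rewrite -[n in b ^+ n]card_ord -prodr_const -big_split /=.
  by apply: eq_bigr => i _; rewrite /s; field.
rewrite -mulrA -alternant_extend_prod; last exact: cheb_monic.
rewrite alternant_extend big_distrr /=; apply: eq_bigr => q _.
have le_qn : (q <= n)%N by rewrite -ltnS.
rewrite !mulrA; congr (_ * _).
have -> : b ^+ n = b ^+ q * b ^+ (n - q) by rewrite -exprD subnKC.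
rewrite -mulrA mulrCA !mulrA -[_ * _ * (cheb _ _).[_]]mulrA phi_cheb //.
rewrite [_ * b ^+ q]mulrC -!mulrA; congr (_ * _); rewrite mulrA -exprD.
by rewrite -addnA subnKC // addnn -signr_odd odd_double mul1r.
Qed.

(** The identity for any values y_i at which Weyl's denominator does not
    vanish. *)
Lemma prod_ch_SO_odd n (y : 'I_n -> F) a b :
    (forall i, y i != 0) -> alt_sum y (rho n) != 0 ->
  \prod_(i < n) (a * (y i + (y i)^-1) + b * (y i ^+ 3 + y i ^- 3)) =
  \sum_(q < n.+1) b ^+ q * phi a b (n - q) * ch_SO_odd y (weight32 n q).
Proof.
move=> y0 rho0; apply: (mulIf rho0).
rewrite big_distrl /=.
under [RHS]eq_bigr => q _ do
  rewrite /ch_SO_odd mulrA divfK // alt_sum_weight32 // mulrCA.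
rewrite -big_distrr /= -prod_gap_alternant alt_sum_rho //.
rewrite !(alternant_monic _ (cheb_monic _)) !mulrA -!big_split.
congr (_ * _); apply: eq_bigr => i _ /=.
by field; exact: y0.
Qed.

End DualCauchy.

(** * Specialization to indeterminates *)

(** By [alternant_neq0] it suffices that the points y_i^2 + y_i^-2 be distinct;
    the difference of two of them is, up to a unit,
    (y_i^2 - y_j^2) (y_i^2 y_j^2 - 1). *)
Lemma alt_sum_rho_neq0 (F : fieldType) n (y : 'I_n -> F) :
    (forall i, y i != 0) -> (forall i, y i ^+ 2 != 1) ->
    (forall i j, i != j -> y i ^+ 2 != y j ^+ 2) ->
    (forall i j, i != j -> y i ^+ 2 * y j ^+ 2 != 1) ->
  alt_sum y (rho n) != 0.
Proof.
move=> y0 y1 yD yM; rewrite alt_sum_rho //; apply: mulf_neq0.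
  apply/prodf_neq0 => i _; apply: contra (y1 i) => /eqP h.
  rewrite -subr_eq0; apply/eqP.
  by transitivity (y i * (y i - (y i)^-1)); [field | rewrite h mulr0].
apply: alternant_neq0; first exact: cheb_monic.
move=> i j h; apply/eqP; apply: contraT => ne_ij.
have := mulf_neq0 (_ : y i ^+ 2 - y j ^+ 2 != 0)
                  (_ : y i ^+ 2 * y j ^+ 2 - 1 != 0).
rewrite !subr_eq0 yD // yM // => /(_ isT isT) /eqP; case.
transitivity (y i ^+ 2 * y j ^+ 2 *
   ((y i ^+ 2 + y i ^- 2) - (y j ^+ 2 + y j ^- 2))).
  by field; rewrite !y0.
by rewrite h subrr mulr0.
Qed.

Lemma rmorph_phi (R S : pzRingType) (f : {rmorphism R -> S}) (a b : R) r :
  f (phi a b r) = phi (f a) (f b) r.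
Proof.
have H : [/\ f (phi a b r) = phi (f a) (f b) r,
    f (phi a b r.+1) = phi (f a) (f b) r.+1 &
    f (phi a b r.+2) = phi (f a) (f b) r.+2].
  elim: r => [|r [IH1 IH2 IH3]].
    by split; rewrite /= ?rmorph1 ?rmorphB ?rmorphM ?rmorphXn ?rmorph_nat.
  split=> //; have E (T : pzRingType) (c d : T) : phi c d r.+3 =
    c * phi c d r.+2 - c * d * phi c d r.+1 + d ^+ 3 * phi c d r by [].
  by rewrite !E rmorphD rmorphB !rmorphM IH1 IH2 IH3.
by case: H.
Qed.

Section Indeterminates.

Variables (R : idomainType) (n : nat).

Lemma tofrac_mpoly_neq (p q : {mpoly R[n]}) (v : 'I_n -> R) :
  p.@[v] != q.@[v] -> tofrac p != tofrac q.
Proof. by rewrite tofrac_eq; apply: contra => /eqP ->. Qed.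

Lemma sqrtx_neq0 (i : 'I_n) : sqrtx R i != 0.
Proof.
rewrite /sqrtx -tofrac0; apply: (@tofrac_mpoly_neq _ _ (fun=> 1)).
by rewrite mevalXU meval0 oner_neq0.
Qed.

(** Distinct polynomials are told apart by their values at points with
    coordinates 0 and 1, which works in every characteristic. *)
Lemma alt_sum_sqrtx_neq0 : alt_sum (@sqrtx R n) (rho n) != 0.
Proof.
pose v0 (i : 'I_n) : R := 0.
apply: alt_sum_rho_neq0 => [i|i|i j ne_ij|i j ne_ij];
  rewrite ?sqrtx_neq0 // /sqrtx.
- rewrite -tofracXn -tofrac1; apply: (@tofrac_mpoly_neq _ _ v0).
  by rewrite rmorphXn /= mevalXU meval1 expr0n eq_sym oner_neq0.
- rewrite -!tofracXn; apply: (@tofrac_mpoly_neq _ _ (fun k => (k == i)%:R)).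
  rewrite !rmorphXn /= !mevalXU eqxx [j == i]eq_sym (negbTE ne_ij).
  by rewrite expr1n expr0n oner_neq0.
rewrite -!tofracXn -tofracM -tofrac1; apply: (@tofrac_mpoly_neq _ _ v0).
by rewrite rmorphM !rmorphXn /= !mevalXU meval1 expr0n mul0r eq_sym oner_neq0.
Qed.

End Indeterminates.

Theorem theorem7p1 (R : idomainType) (n : nat) (hn : (1 <= n)%N)
    (a12 a32 : R) :
  \prod_(i < n)
     (scal n a12 * (sqrtx R i + (sqrtx R i)^-1) +
      scal n a32 * (sqrtx R i ^+ 3 + sqrtx R i ^- 3))
  = \sum_(q < n.+1)
      scal n (a32 ^+ q * phi a12 a32 (n - q))
      * ch_SO_odd (@sqrtx R n) (weight32 n q).
Proof.
rewrite prod_ch_SO_odd; last exact: alt_sum_sqrtx_neq0.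
  apply: eq_bigr => q _; congr (_ * _).
  pose f : {rmorphism R -> {fraction {mpoly R[n]}}} :=
    @tofrac {mpoly R[n]} \o @mpolyC n R.
  rewrite -[scal n a12]/(f a12) -[scal n a32]/(f a32) -[RHS]/(f _).
  by rewrite rmorphM rmorphXn rmorph_phi.
exact: sqrtx_neq0.
Qed.
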